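(* Let $R$ be a commutative ring with identity, let $M$ be an $R$-module, and let $C$ be a strongly semiprime submodule of $M$. Then $C$ is an intersection of some strongly prime submodules of $M$.
   Context: All rings are commutative with identity and all modules are unitary. For a submodule $N$ of an $R$-module $M$ and $x\in M$, put $I_x^N=(N+Rx:M)=\{r\in R\mid rM\subseteq N+Rx\}$, an ideal of $R$. A proper submodule $P$ of $M$ is called strongly prime if, for all $x,y\in M$, $I_x^P y\subseteq P$ implies $x\in P$ or $y\in P$. A proper submodule $C$ of $M$ is called strongly semiprime if, for all $x\in M$, $I_x^C x\subseteq C$ implies $x\in C$. *)

(* Defs.v *)
From mathcomp Require Import all_boot all_algebra.
From mathcomp Require Import boolp classical_sets.

Set Implicit Arguments.
Unset Strict Implicit.
Unset Printing Implicit Defensive.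

Import GRing.Theory.
Local Open Scope ring_scope.
Local Open Scope classical_set_scope.

(* Submodules are Prop-valued sets, so that no decidability is involved; the
   library predicate applies to them through [in N] (membership in N made
   boolean by excluded middle). [comPzRingType] does not exclude the zero
   ring. *)
Definition submodule (R : comPzRingType) (M : lmodType R) (N : set M) : Prop :=
  GRing.submod_closed [in N].

Definition proper_submodule (R : comPzRingType) (M : lmodType R)
    (N : set M) : Prop :=
  submodule N /\ N <> setT.

(* N + R x *)
Definition add_cyclic (R : comPzRingType) (M : lmodType R)
    (N : set M) (x : M) : set M :=
  [set n + r *: x | n in N & r in [set: R]].

(* (N : M) *)
Definition colon (R : comPzRingType) (M : lmodType R) (N : set M) : set R :=
  [set r | [set r *: m | m in [set: M]] `<=` N].

(* I_x^N = (N + R x : M) *)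
Definition colon_ideal (R : comPzRingType) (M : lmodType R)
    (N : set M) (x : M) : set R :=
  colon (add_cyclic N x).

Definition strongly_prime (R : comPzRingType) (M : lmodType R)
    (P : set M) : Prop :=
  proper_submodule P /\
  forall x y : M,
    [set r *: y | r in colon_ideal P x] `<=` P -> P x \/ P y.

Definition strongly_semiprime (R : comPzRingType) (M : lmodType R)
    (C : set M) : Prop :=
  proper_submodule C /\
  forall x : M, [set r *: x | r in colon_ideal C x] `<=` C -> C x.

(* Main.v *)
Require Import Defs.
From mathcomp Require Import all_boot all_algebra.
From mathcomp Require Import boolp classical_sets.

(** If [a] is not in [C], strong semiprimeness yields a sequence [a_0 = a],
    [a_(k+1) = r_k a_k] outside [C] with [r_k M <= C + R a_k]. A submodule [P]
    containing [C] and maximal among those avoiding every [a_k] is strongly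
    prime: if [x] and [y] are not in [P], then some [a_k] lies in both [P + R x]
    and [P + R y], so [r_k] is in [I_x^P], and [r_k y] in [P] would force
    [a_(k+1) = r_k a_k] into [P]. *)

Set Implicit Arguments.
Unset Strict Implicit.
Unset Printing Implicit Defensive.

Import GRing.Theory.
Local Open Scope ring_scope.
Local Open Scope classical_set_scope.

Section Submodules.
Variables (R : comPzRingType) (M : lmodType R).
Implicit Types (N C P S : set M) (x y : M).

Lemma submoduleP N :
  submodule N <-> N 0 /\ forall (a : R) u v, N u -> N v -> N (a *: u + v).
Proof.
split=> -[N0 NL]; split.
- by move: N0; rewrite inE.
- by move=> a u v Nu Nv; apply/set_mem/NL; apply/mem_set.
- exact/mem_set.
- by move=> a u v /set_mem Nu /set_mem Nv; apply/mem_set/NL.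
Qed.

Lemma submoduleZ N a u : submodule N -> N u -> N (a *: u).
Proof.
by move=> /submoduleP[N0 NL] Nu; rewrite -[_ *: _]addr0; apply: NL.
Qed.

Lemma submoduleD N u v : submodule N -> N u -> N v -> N (u + v).
Proof.
by move=> /submoduleP[_ NL] Nu Nv; rewrite -[u]scale1r; apply: NL.
Qed.

Lemma submodule_add_cyclic N x : submodule N -> submodule (add_cyclic N x).
Proof.
move=> /submoduleP[N0 NL]; apply/submoduleP; split.
  by exists 0 => //; exists 0 => //; rewrite scale0r addr0.
move=> a _ _ [n Nn [r _ <-]] [m Nm [s _ <-]].
exists (a *: n + m); first exact: NL.
by exists (a * r + s) => //; rewrite scalerDl scalerDr scalerA addrACA.
Qed.

Lemma sub_add_cyclic N x : N `<=` add_cyclic N x.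
Proof. by move=> n Nn; exists n => //; exists 0 => //; rewrite scale0r addr0. Qed.

Lemma mem_add_cyclic N x : submodule N -> add_cyclic N x x.
Proof.
by move=> /submoduleP[N0 _]; exists 0 => //; exists 1 => //; rewrite scale1r add0r.
Qed.

Lemma add_cyclic_sub C N x :
  submodule N -> C `<=` N -> N x -> add_cyclic C x `<=` N.
Proof.
move=> Nsub CN Nx _ [c Cc [r _ <-]].
by apply: submoduleD => //; [exact: CN | exact: submoduleZ].
Qed.

(** A nonempty [F] supplies [0]; two elements of the union lie together in the larger of their two
    sets. *)
Lemma submodule_bigcup_chain (F : set (set M)) :
  F !=set0 -> total_on F subset -> F `<=` @submodule R M ->
  submodule (\bigcup_(X in F) X).
Proof.
move=> [X0 FX0] Ftot Fsub; apply/submoduleP; split.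
  by exists X0 => //; have /submoduleP[] := Fsub _ FX0.
move=> a u v [X FX Xu] [Y FY Yv].
have /submoduleP[_ XL] := Fsub _ FX; have /submoduleP[_ YL] := Fsub _ FY.
case: (Ftot _ _ FX FY) => sub; first by exists Y => //; apply: YL => //; exact: sub.
by exists X => //; apply: XL => //; exact: sub.
Qed.

Lemma exists_maximal_submodule C S :
  submodule C -> C `&` S = set0 ->
  exists P, [/\ submodule P, C `<=` P, P `&` S = set0 &
    forall N, submodule N -> P `<=` N -> N `&` S = set0 -> N `<=` P].
Proof.
move=> Csub CS.
(* [Zorn_bigcup] includes the empty chain, whose union is empty: adjoining [C]
   makes the empty set admissible. *)
pose good X := submodule (C `|` X) /\ (C `|` X) `&` S = set0.
have [F Fgood Ftot|A [[Asub AS] Amax]] := @Zorn_bigcup M good.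
  pose G := [set C `|` X | X in F `|` [set set0]].
  have -> : good (\bigcup_(X in F) X) =
      (submodule (\bigcup_(X in G) X) /\ (\bigcup_(X in G) X) `&` S = set0).
    rewrite /good; suff -> : C `|` \bigcup_(X in F) X = \bigcup_(X in G) X by [].
    rewrite bigcup_image; apply/seteqP; split=> [x [Cx|[X FX Xx]]|x [X [FX|->]]].
    - by exists set0; [right | left].
    - by exists X; [left | right].
    - by case=> [Cx|Xx]; [left | right; exists X].
    - by case=> // Cx; left.
  have Ggood X : (F `|` [set set0]) X -> good X.
    by case=> [/Fgood//|->]; rewrite /good setU0.
  split; last first.
    rewrite -subset0 => x [[_ [X FX <-] CXx] Sx].
    by have [_ <-] := Ggood _ FX.
  apply: submodule_bigcup_chain.
  - by exists (C `|` set0); exists set0 => //; right.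
  - move=> _ _ [X FX <-] [Y FY <-].
    suff: X `<=` Y \/ Y `<=` X by case; [left | right]; exact: setUS.
    case: FX => [FX|->]; last by left.
    by case: FY => [FY|->]; [exact: Ftot | right].
  - by move=> _ [X /Ggood[? _] <-].
(* The Zorn-maximal [A] need not contain [C], so [C] is joined to it. A good [N] above this union
   but not inside it would strictly contain [A]. *)
exists (C `|` A); split=> // N Nsub CAN NS.
apply: contrapT => NnCA; apply: (Amax N).
  split=> [|NA]; first by move=> x Ax; apply: CAN; right.
  by apply: NnCA => x /NA; right.
have CN : C `<=` N by move=> x Cx; apply: CAN; left.
by rewrite /good (iffRL (setUidPr _ _) CN).
Qed.

(** Contrapositive of the strong semiprimeness condition, with the multipliers chosen uniformly in
    [x] so that the sequence is a plain iteration. *)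
Lemma strongly_semiprime_step C :
  strongly_semiprime C ->
  exists f : M -> R, forall x, ~ C x -> colon_ideal C x (f x) /\ ~ C (f x *: x).
Proof.
move=> [_ Csp]; suff /choice[f fP] : forall x, exists r,
  ~ C x -> colon_ideal C x r /\ ~ C (r *: x) by exists f.
move=> x; apply: contrapT => /forallNP nr.
(* For [x] in [C] the required implication is vacuous, so [0] is an arbitrary value. *)
have nCx : ~ C x by move=> Cx; exact: (nr 0).
apply: nCx; apply: Csp => _ [r Ir <-]; apply: contrapT => nCrx.
by apply: (nr r).
Qed.

Lemma strongly_prime_avoiding C a :
  strongly_semiprime C -> ~ C a ->
  exists P, [/\ strongly_prime P, C `<=` P & ~ P a].
Proof.
move=> Csp nCa; have [f fP] := strongly_semiprime_step Csp.
have [[Csub _] _] := Csp.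
pose s k := iter k (fun x => f x *: x) a.
have nCs k : ~ C (s k) by elim: k => //= k /fP[].
have CS : C `&` range s = set0.
  by rewrite -subset0 => x [Cx [k _ sk]]; apply: (nCs k); rewrite sk.
have [P [Psub CP PS Pmax]] := exists_maximal_submodule Csub CS.
have nPs k : ~ P (s k) by move=> Psk; rewrite -[False]/(set0 (s k)) -PS; split.
exists P; split=> //; last exact: (nPs 0%N).
split; first by split=> // PT; apply: (nPs 0%N); rewrite PT.
(* If [P + R x] missed the whole sequence, maximality would put it, and so [x], inside [P]. *)
have reach x : ~ P x -> exists k, add_cyclic P x (s k).
  move=> nPx; apply: contrapT => nk; apply: nPx.
  apply: (Pmax (add_cyclic P x)); [exact: submodule_add_cyclic
    | exact: sub_add_cyclic | | exact: mem_add_cyclic].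
  rewrite -subset0 => z [Pxz [k _ skz]]; apply: nk; exists k; by rewrite skz.
(* Each term is a multiple of the one before, so the index [i + j] will serve both [x] and [y]. *)
have later N k i : submodule N -> N (s k) -> N (s (i + k)%N).
  by move=> Nsub Nk; elim: i => // i; rewrite addSn; exact: submoduleZ.
move=> x y Ixy; apply: contrapT => /not_orP[/reach[i Pxi] /reach[j Pyj]].
pose k := (i + j)%N.
have Pxk : add_cyclic P x (s k).
  by rewrite /k addnC; apply: later => //; exact: submodule_add_cyclic.
have [p Pp [r _ spr]] : add_cyclic P y (s k).
  by apply: later => //; exact: submodule_add_cyclic.
have [Ik _] := fP _ (nCs k).
(* [f (s k)] sends [M] into [C + R s_k], which lies in [P + R x]; hence it belongs to [I_x^P]. *)
have Pfy : P (f (s k) *: y).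
  apply: Ixy; exists (f (s k)) => // z /Ik.
  apply: add_cyclic_sub => //; first exact: submodule_add_cyclic.
  by apply: subset_trans (@sub_add_cyclic _ _).
(* With [s k = p + r y], the next term is [f (s k) p + r (f (s k) y)], and both summands lie in
   [P]. *)
apply: (nPs k.+1); rewrite /= -/(s k) -{2}spr scalerDr scalerA mulrC -scalerA.
by apply: submoduleD => //; apply: submoduleZ.
Qed.

End Submodules.

Unset Implicit Arguments.

Theorem theorem1p7 (R : comPzRingType) (M : lmodType R) (C : set M)
    (hC : strongly_semiprime C) :
  exists F : set (set M),
    (forall P : set M, F P -> strongly_prime P) /\ C = \bigcap_(P in F) P.
Proof.
(* The largest candidate family: any set in a family with intersection [C] contains [C]. *)
exists [set P | strongly_prime P /\ C `<=` P]; split=> [P []//|].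
apply/seteqP; split=> [x Cx P [_ CP]|x Fx]; first exact: CP.
apply: contrapT => nCx.
have [P [Pprime CP nPx]] := strongly_prime_avoiding hC nCx.
by apply: nPx; apply: Fx.
Qed.
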